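(* Consider the or-constrained program (MPOC) and its nonsmooth reformulation $$\text{(MPOC}(\varphi_{\mathrm{FB}})\text{)}\qquad \min_x f(x)\ \text{ s.t. }\ g_i(x)\le 0\ (i\in\mathcal M),\quad h_j(x)=0\ (j\in\mathcal P),\quad \varphi_{\mathrm{FB}}(G_l(x),H_l(x))\le 0\ (l\in\mathcal Q),$$ where $\varphi_{\mathrm{FB}}(a,b):=a+b-\sqrt{a^2+b^2}$. For a feasible point $\bar x\in\mathbb R^n$ of (MPOC), the following statements are equivalent: (a) $\bar x$ is W-stationary for (MPOC); (b) $\bar x$ is a KKT point of (MPOC$(\varphi_{\mathrm{FB}})$) with respect to Clarke's subdifferential; (c) $\bar x$ is a KKT point of (MPOC$(\varphi_{\mathrm{FB}})$) with respect to Mordukhovich's subdifferential.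
   Context: Let $n,m,p,q$ be positive integers, $\mathcal M:=\{1,\dots,m\}$, $\mathcal P:=\{1,\dots,p\}$, $\mathcal Q:=\{1,\dots,q\}$, and let $f,g_i,h_j,G_l,H_l\colon\mathbb R^n\to\mathbb R$ be continuously differentiable for all $i\in\mathcal M$, $j\in\mathcal P$, $l\in\mathcal Q$. The program (MPOC) is: minimize $f(x)$ subject to $g_i(x)\le 0$ ($i\in\mathcal M$), $h_j(x)=0$ ($j\in\mathcal P$), and ($G_l(x)\le 0$ or $H_l(x)\le 0$) for all $l\in\mathcal Q$. Its feasible set $X$ coincides with that of (MPOC$(\varphi_{\mathrm{FB}})$). For $\bar x\in X$ put $I^g(\bar x):=\{i\in\mathcal M: g_i(\bar x)=0\}$, $I^{0+}(\bar x):=\{l\in\mathcal Q: G_l(\bar x)=0,\ H_l(\bar x)>0\}$, $I^{+0}(\bar x):=\{l\in\mathcal Q: G_l(\bar x)>0,\ H_l(\bar x)=0\}$, $I^{00}(\bar x):=\{l\in\mathcal Q: G_l(\bar x)=0,\ H_l(\bar x)=0\}$. A point $\bar x\in X$ is W-stationary for (MPOC) if there are multipliers $\lambda_i\ge0$ ($i\in I^g(\bar x)$), $\rho_j\in\mathbb R$ ($j\in\mathcal P$), $\mu_l\ge 0$ ($l\in I^{0+}(\bar x)\cup I^{00}(\bar x)$), $\nu_l\ge0$ ($l\in I^{+0}(\bar x)\cup I^{00}(\bar x)$) with $$0=\nabla f(\bar x)+\sum_{i\in I^g(\bar x)}\lambda_i\nabla g_i(\bar x)+\sum_{j\in\mathcal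 P}\rho_j\nabla h_j(\bar x)+\sum_{l\in I^{0+}(\bar x)\cup I^{00}(\bar x)}\mu_l\nabla G_l(\bar x)+\sum_{l\in I^{+0}(\bar x)\cup I^{00}(\bar x)}\nu_l\nabla H_l(\bar x).$$ Subdifferentials: for a locally Lipschitz $\psi\colon\mathbb R^k\to\mathbb R$, the Fréchet subdifferential at $\bar x$ is $\partial^{\mathrm F}\psi(\bar x):=\{y:\liminf_{x\to\bar x}(\psi(x)-\psi(\bar x)-y\cdot(x-\bar x))/\|x-\bar x\|_2\ge0\}$; the Mordukhovich subdifferential $\partial^{\mathrm M}\psi(\bar x)$ is the set of all limits $y=\lim y_k$ with $y_k\in\partial^{\mathrm F}\psi(x_k)$ and $x_k\to\bar x$; the Clarke subdifferential $\partial^{\mathrm C}\psi(\bar x)$ is the closed convex hull of $\partial^{\mathrm M}\psi(\bar x)$. KKT points of (MPOC$(\varphi)$) for locally Lipschitz $\varphi$: let $I^{\varphi}(\bar x):=\{l\in\mathcal Q:\varphi(G_l(\bar x),H_l(\bar x))=0\}$. A feasible point $\bar x$ is a KKT point with respect to Clarke's (resp. Mordukhovich's) subdifferential if there are $\lambda_i\ge 0$ ($i\in I^g(\bar x)$), $\rho_j\in\mathbb R$ ($j\in\mathcal P$), and, for each $l\in I^\varphi(\bar x)$, a scalar $\xi_l\ge0$ and a pair $(\alpha_l,\beta_l)\in\partial^{\mathrm C}\varphi(G_l(\bar x),H_l(\bar x))$ (resp. $\partial^{\mathrm M}\varphi(G_l(\bar x),H_l(\bar x))$) such that $$0=\nabla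 f(\bar x)+\sum_{i\in I^g(\bar x)}\lambda_i\nabla g_i(\bar x)+\sum_{j\in\mathcal P}\rho_j\nabla h_j(\bar x)+\sum_{l\in I^\varphi(\bar x)}\xi_l\bigl(\alpha_l\nabla G_l(\bar x)+\beta_l\nabla H_l(\bar x)\bigr).$$ *)

(* Defs.v *)
From HB Require Import structures.
From mathcomp Require Import all_boot all_order all_algebra.
From mathcomp Require Import all_classical all_reals all_analysis.

Set Implicit Arguments.
Unset Strict Implicit.
Unset Printing Implicit Defensive.

Import Order.TTheory GRing.Theory Num.Theory.
Import numFieldNormedType.Exports.

Local Open Scope classical_set_scope.
Local Open Scope ring_scope.

Section Euclidean.
Context {R : realType} {k : nat}.
Implicit Types (x y : 'rV[R]_k) (psi : 'rV[R]_k -> R).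

Definition dot x y : R := \sum_i x 0 i * y 0 i.

(* The library norm `|x| on 'rV[R]_k is the sup norm; this is the 2-norm. *)
Definition norm2 x : R := Num.sqrt (dot x x).

Definition gradient psi x : 'rV[R]_k := \row_i 'D_(delta_mx 0 i) psi x.

Definition continuously_differentiable psi : Prop :=
  (forall x, differentiable psi x) /\ continuous (gradient psi).

End Euclidean.

Section Subdifferentials.
Context {R : realType} {k : nat}.
Implicit Types (psi : 'rV[R]_k -> R) (x : 'rV[R]_k).

Definition frechet_subdiff psi x : set 'rV[R]_k :=
  [set y | (0%:E <= limf_einf
     (fun z => ((psi z - psi x - dot y (z - x)) / norm2 (z - x))%:E) x^')%E].

Definition mordukhovich_subdiff psi x : set 'rV[R]_k :=
  [set y | exists x_ y_ : nat -> 'rV[R]_k,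
     [/\ forall j, frechet_subdiff psi (x_ j) (y_ j),
         x_ j @[j --> \oo] --> x & y_ j @[j --> \oo] --> y]].

Definition convex_hull (A : set 'rV[R]_k) : set 'rV[R]_k :=
  smallest (@convex_set R 'rV[R]_k) A.

Definition clarke_subdiff psi x : set 'rV[R]_k :=
  closure (convex_hull (mordukhovich_subdiff psi x)).

End Subdifferentials.

Section RealPairs.
Context {R : realType}.

Definition pair2 (a b : R) : 'rV[R]_2 := \row_(i < 2) [:: a; b]`_i.

Definition phi_FB (z : 'rV[R]_2) : R :=
  z 0 0 + z 0 1 - Num.sqrt (z 0 0 ^+ 2 + z 0 1 ^+ 2).

End RealPairs.

Section MPOC.
Context {R : realType} {n m p q : nat}.
Variables (f : 'rV[R]_n -> R).
Variables (g : 'I_m -> 'rV[R]_n -> R) (h : 'I_p -> 'rV[R]_n -> R).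
Variables (G H : 'I_q -> 'rV[R]_n -> R).
Implicit Types (x : 'rV[R]_n) (phi : 'rV[R]_2 -> R).

Definition mpoc_feasible x : Prop :=
  [/\ forall i, g i x <= 0,
      forall j, h j x = 0 &
      forall l, G l x <= 0 \/ H l x <= 0].

Definition mpoc_phi_feasible phi x : Prop :=
  [/\ forall i, g i x <= 0,
      forall j, h j x = 0 &
      forall l, phi (pair2 (G l x) (H l x)) <= 0].

Definition I_g x : {set 'I_m} := [set i | g i x == 0]%SET.
Definition I_0p x : {set 'I_q} := [set l | (G l x == 0) && (0 < H l x)]%SET.
Definition I_p0 x : {set 'I_q} := [set l | (0 < G l x) && (H l x == 0)]%SET.
Definition I_00 x : {set 'I_q} := [set l | (G l x == 0) && (H l x == 0)]%SET.
Definition I_phi phi x : {set 'I_q} :=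
  [set l | phi (pair2 (G l x) (H l x)) == 0]%SET.

(* Multipliers are total families; only their values on the relevant index
   set are constrained and enter the sums. *)
Definition W_stationary x : Prop :=
  mpoc_feasible x /\
  exists (lambda : 'I_m -> R) (rho : 'I_p -> R) (mu nu : 'I_q -> R),
    [/\ forall i, i \in I_g x -> 0 <= lambda i,
        forall l, l \in (I_0p x :|: I_00 x)%SET -> 0 <= mu l,
        forall l, l \in (I_p0 x :|: I_00 x)%SET -> 0 <= nu l &
        0 = gradient f x
            + \sum_(i in I_g x) lambda i *: gradient (g i) x
            + \sum_j rho j *: gradient (h j) x
            + \sum_(l in (I_0p x :|: I_00 x)%SET) mu l *: gradient (G l) x
            + \sum_(l in (I_p0 x :|: I_00 x)%SET) nu l *: gradient (H l) x].

Definition KKT_point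
    (subdiff : ('rV[R]_2 -> R) -> 'rV[R]_2 -> set 'rV[R]_2) phi x : Prop :=
  mpoc_phi_feasible phi x /\
  exists (lambda : 'I_m -> R) (rho : 'I_p -> R) (xi alpha beta : 'I_q -> R),
    [/\ forall i, i \in I_g x -> 0 <= lambda i,
        forall l, l \in I_phi phi x -> 0 <= xi l,
        forall l, l \in I_phi phi x ->
          subdiff phi (pair2 (G l x) (H l x)) (pair2 (alpha l) (beta l)) &
        0 = gradient f x
            + \sum_(i in I_g x) lambda i *: gradient (g i) x
            + \sum_j rho j *: gradient (h j) x
            + \sum_(l in I_phi phi x)
                xi l *: (alpha l *: gradient (G l) x
                         + beta l *: gradient (H l) x)].

End MPOC.

(* Main.v *)
Require Import Defs.
From mathcomp Require Import all_boot all_order all_algebra.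
From mathcomp Require Import all_classical all_reals all_analysis.
From mathcomp Require Import ring lra.

Set Implicit Arguments.
Unset Strict Implicit.
Unset Printing Implicit Defensive.

Import Order.TTheory GRing.Theory Num.Theory.
Import numFieldNormedType.Exports.

Local Open Scope classical_set_scope.
Local Open Scope ring_scope.

(** The equivalence holds because, at every zero of the Fischer-Burmeister
    function phi, the Mordukhovich and the Clarke subdifferential generate the
    same cone of multipliers, and that cone is the sign pattern which
    W-stationarity imposes on the pairs (mu_l, nu_l).  The active index set of
    the reformulation splits accordingly: I^{0+} with I^{00} is its part where
    G vanishes ([I_0p_00E]), I^{+0} with I^{00} its part where H vanishes
    ([I_p0_00E]).

    To compute the subdifferentials, write phi(z) = (1,1).z - |z|.  This
    function is concave, and a supergradient at a point equals every Frechet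
    subgradient there ([frechet_subdiff_supergradient]).  So the Frechet
    subdifferential is empty at the origin, which has several supergradients,
    and at any other z it is {(1,1) - z/|z|}, the gradient.  Its elements have
    nonnegative coordinates since z/|z| is a unit vector.

    From Clarke stationarity to W-stationarity: the limits of such gradients
    have nonnegative coordinates, and at (a,0) or (0,b) with a, b > 0 the only
    limit is (0,1), resp. (1,0).  These facts are linear inequalities, so they
    pass to closed convex hulls ([clarke_subdiff_halfspace]), and
    [clarke_phi_FB_cone] follows.

    From W-stationarity to Mordukhovich stationarity: away from the origin the
    subgradient (0,1) or (1,0) is scaled.  At the origin every (1,1) - u with u
    a unit vector is a limiting subgradient, namely the constant gradient along
    the ray spanned by u.  These points form the unit circle centred at (1,1),
    which touches both coordinate axes, so each ray of the nonnegative quadrant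
    meets it ([mordukhovich_phi_FB_cone]).

    The remaining implication is the inclusion of the Mordukhovich
    subdifferential in its closed convex hull. *)

(** * The Euclidean norm *)

Section EuclideanSpace.
Context {R : realType} {k : nat}.
Implicit Types (x y z w s : 'rV[R]_k) (t : R).

Lemma dotDl x y z : dot (x + y) z = dot x z + dot y z.
Proof.
rewrite /dot -big_split /=; apply: eq_bigr => i _.
by rewrite mxE mulrDl.
Qed.

Lemma dotZl t x y : dot (t *: x) y = t * dot x y.
Proof.
by rewrite /dot mulr_sumr; apply: eq_bigr => i _; rewrite mxE mulrA.
Qed.

Lemma dotC x y : dot x y = dot y x.
Proof. by apply: eq_bigr => i _; rewrite mulrC. Qed.

Lemma dotDr x y z : dot z (x + y) = dot z x + dot z y.
Proof. by rewrite dotC dotDl !(dotC z). Qed.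

Lemma dotZr t x y : dot x (t *: y) = t * dot x y.
Proof. by rewrite dotC dotZl dotC. Qed.

Lemma dotBl x y z : dot (x - y) z = dot x z - dot y z.
Proof. by rewrite dotDl -scaleN1r dotZl mulN1r. Qed.

Lemma dotBr x y z : dot z (x - y) = dot z x - dot z y.
Proof. by rewrite dotC dotBl !(dotC z). Qed.

Lemma dot_ge0 x : 0 <= dot x x.
Proof. by apply: sumr_ge0 => i _; rewrite -expr2 sqr_ge0. Qed.

Lemma norm2_ge0 x : 0 <= norm2 x.
Proof. exact: sqrtr_ge0. Qed.

Lemma sqr_norm2 x : norm2 x ^+ 2 = dot x x.
Proof. by rewrite sqr_sqrtr ?dot_ge0. Qed.

Lemma norm2_eq0 x : (norm2 x == 0) = (x == 0).
Proof.
apply/eqP/eqP => [x0|->]; last first.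
  by rewrite /norm2 /dot big1 ?sqrtr0// => i _; rewrite mxE mul0r.
have /eqP : dot x x = 0 by rewrite -sqr_norm2 x0 expr0n.
rewrite psumr_eq0 => [/allP h|i _]; last by rewrite -expr2 sqr_ge0.
apply/rowP => i; rewrite mxE.
by have := h i; rewrite mem_index_enum => /(_ isT); rewrite mulf_eq0 orbb => /eqP.
Qed.

Lemma norm2_gt0 x : (0 < norm2 x) = (x != 0).
Proof. by rewrite lt_neqAle norm2_ge0 andbT eq_sym norm2_eq0. Qed.

Lemma norm2Z t x : 0 <= t -> norm2 (t *: x) = t * norm2 x.
Proof.
move=> t0; rewrite /norm2 dotZl dotZr mulrA sqrtrM -?expr2 ?sqr_ge0//.
by rewrite sqrtr_sqr ger0_norm.
Qed.

Lemma cvg_dot T (F : set_system T) {FF : Filter F} (u v : T -> 'rV[R]_k) x y :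
  u @ F --> x -> v @ F --> y -> dot (u t) (v t) @[t --> F] --> dot x y.
Proof.
move=> ux vy; rewrite /dot; apply: cvg_big => [|i _].
  exact: (@add_continuous R).
by apply: cvgM; apply: (@continuous_cvg _ _ _ _ _ _ (fun z : 'rV[R]_k => z 0 i)) => //;
  exact: coord_continuous.
Qed.

Lemma cvg_norm2 T (F : set_system T) {FF : Filter F} (u : T -> 'rV[R]_k) x :
  u @ F --> x -> norm2 (u t) @[t --> F] --> norm2 x.
Proof.
move=> ux; have h : dot (u t) (u t) @[t --> F] --> dot x x by exact: cvg_dot.
exact: (cvg_comp _ _ h (@sqrt_continuous R _)).
Qed.

End EuclideanSpace.

(** * Frechet, Mordukhovich and Clarke subdifferentials *)

Section FrechetSubdifferential.
Context {R : realType} {k : nat}.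
Implicit Types (psi : 'rV[R]_k -> R) (x y s : 'rV[R]_k).

(** Clearing the denominator turns the liminf condition into an epsilon
    condition on a full neighbourhood, since both sides vanish at [x]. *)
Lemma frechet_subdiffP psi x y :
  frechet_subdiff psi x y <->
  forall e : R, 0 < e ->
    \forall z \near x, - (e * norm2 (z - x)) <= psi z - psi x - dot y (z - x).
Proof.
rewrite /frechet_subdiff /= limf_einfE; split=> [Fy e e0|Fy].
  have : ((- e)%:E < ereal_sup [set ereal_inf [set
     ((psi z - psi x - dot y (z - x)) / norm2 (z - x))%:E | z in V] | V in x^'])%E.
    by apply: lt_le_trans Fy; rewrite lte_fin oppr_lt0.
  move=> /ereal_sup_gt[_ [V xV <-] eV].
  move: xV; rewrite /dnbhs /within /=; apply: filterS => z Vz.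
  have [->|zx] := eqVneq z x.
    rewrite !subrr sub0r.
    have /eqP-> : norm2 (0 : 'rV[R]_k) == 0 by rewrite norm2_eq0.
    by rewrite -[X in dot y X](scale0r 0) dotZr mul0r mulr0 oppr0.
  have := lt_le_trans eV (ereal_inf_lbound (ex_intro2 _ _ z (Vz zx) erefl)).
  rewrite lte_fin ltr_pdivlMr ?norm2_gt0 ?subr_eq0// mulNr.
  exact: ltW.
apply/lee_subgt0Pr => e e0; rewrite sub0e.
apply: ereal_sup_ge.
pose V := [set z | z != x /\
  - (e * norm2 (z - x)) <= psi z - psi x - dot y (z - x)].
eexists.
  exists V; last reflexivity.
  rewrite /dnbhs /within /=; apply: filterS (Fy _ e0) => z /= hz zx.
  by split.
apply/ereal_infP => _ [z [zx hz] <-].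
by rewrite -EFinN lee_fin ler_pdivlMr ?norm2_gt0 ?subr_eq0// mulNr.
Qed.

(** A quadratic error is negligible against the norm, so proximal
    subgradients are Frechet subgradients; this avoids differentiating the
    norm. *)
Lemma proximal_frechet_subdiff psi x y (C : R) :
    (forall z, - (C * norm2 (z - x) ^+ 2) <= psi z - psi x - dot y (z - x)) ->
  frechet_subdiff psi x y.
Proof.
move=> hC; apply/frechet_subdiffP => e e0.
have C0 : 0 < `|C| + 1 by rewrite ltr_wpDl.
have cn : norm2 (z - x) @[z --> x] --> (0 : R).
  have -> : (0 : R) = norm2 (x - x) by apply/esym/eqP; rewrite norm2_eq0 subrr.
  have cB : z - x @[z --> x] --> x - x.
    by apply: (@cvgB R _ _ (nbhs x)); [exact: cvg_id|exact: cvg_cst].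
  exact: (@cvg_norm2 _ _ _ (nbhs x) _ _ _ cB).
have d0 := divr_gt0 e0 C0.
near=> z.
have hz : norm2 (z - x) * (`|C| + 1) < e.
  rewrite -ltr_pdivlMr//; near: z; exact: cvgr_lt cn _ d0.
apply: le_trans (hC z); rewrite lerN2 expr2 mulrA.
apply: ler_wpM2r; first exact: norm2_ge0.
apply: le_trans (ltW hz); rewrite mulrC ler_wpM2l ?norm2_ge0//.
by apply: le_trans (ler_norm _) _; rewrite lerDl.
Unshelve. all: by end_near. Qed.

(** Moving from [x] along [w := y - s], the subgradient forces a growth of at
    least [y.w - o(1)] and the supergradient allows at most [s.w]; hence
    [w.w <= 0]. *)
Lemma frechet_subdiff_supergradient psi x y s :
    (forall z, psi z - psi x <= dot s (z - x)) -> frechet_subdiff psi x y ->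
  y = s.
Proof.
move=> hs /frechet_subdiffP Fy.
apply/eqP; rewrite -subr_eq0; set w := y - s; apply/negPn/negP => w0.
have nw : 0 < norm2 w by rewrite norm2_gt0.
(* With e = |w|/2 the two bounds give |w|^2 <= |w|^2/2. *)
have e0 : 0 < norm2 w / 2 by rewrite divr_gt0.
have cx : x + t *: w @[t --> (0 : R)^'+] --> x.
  rewrite -[X in _ --> X]addr0; apply: (@cvgD R); first exact: cvg_cst.
  rewrite -[X in _ --> X](scale0r w); apply: (@cvgZ R); last exact: cvg_cst.
  exact: cvg_at_right_filter cvg_id.
have : \forall t \near (0 : R)^'+, 0 < t /\
    - (norm2 w / 2 * norm2 (x + t *: w - x)) <=
      psi (x + t *: w) - psi x - dot y (x + t *: w - x).
  apply: filterI; first exact: nbhs_right_gt.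
  exact: cx (Fy _ e0).
move=> /filter_ex[t [t0]].
have := hs (x + t *: w).
have -> : x + t *: w - x = t *: w by rewrite addrAC subrr add0r.
rewrite (norm2Z _ (ltW t0)) !dotZr => h1 h2.
have := sqr_norm2 w; rewrite {2}/w dotBl => h3.
have : t * norm2 w ^+ 2 <= t * (norm2 w ^+ 2 / 2).
  rewrite h3 mulrBr -h3; lra.
by rewrite ler_pM2l//; have := exprn_gt0 2 nw; lra.
Qed.

Lemma frechet_sub_mordukhovich psi x y (v : nat -> 'rV[R]_k) :
    v j @[j --> \oo] --> x -> (forall j, frechet_subdiff psi (v j) y) ->
  mordukhovich_subdiff psi x y.
Proof. by move=> vx Fy; exists v, (fun=> y); split=> //; exact: cvg_cst. Qed.

Lemma mordukhovich_sub_clarke psi x :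
  mordukhovich_subdiff psi x `<=` clarke_subdiff psi x.
Proof.
apply: subset_trans (@subset_closure _ _).
exact: sub_gen_smallest.
Qed.

(** A half-space is closed and convex, so it contains the closed convex hull
    of each of its subsets. *)
Lemma clarke_subdiff_halfspace psi x w (c : R) :
    (forall y, mordukhovich_subdiff psi x y -> c <= dot w y) ->
  forall y, clarke_subdiff psi x y -> c <= dot w y.
Proof.
move=> hM; pose A := [set y | c <= dot w y].
have cA : closed A.
  apply: (@preimage_closed _ _ (dot w) [set u | c <= u]) => [z _|].
    by apply: (@cvg_dot _ _ _ (nbhs z)); [exact: cvg_cst|exact: cvg_id].
  exact: closed_ge.
suff : clarke_subdiff psi x `<=` A by [].
rewrite (closure_id A).1//; apply: closureS.
apply: smallest_sub => //.
move=> a b t; rewrite !inE /A /= => ha hb.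
rewrite /conv /= dotDr !dotZr /unstable.onem.
have t0 : 0 <= t%:num by [].
have t1 : t%:num <= 1 by [].
nra.
Qed.

End FrechetSubdifferential.

(** * Subdifferentials of the Fischer-Burmeister function *)

Section UnitVector.
Context {R : realType} {k : nat}.
Implicit Types (u x z : 'rV[R]_k).

Lemma sqr_norm2B x z :
  norm2 (z - x) ^+ 2 = norm2 z ^+ 2 - 2 * dot x z + norm2 x ^+ 2.
Proof.
rewrite !sqr_norm2 dotBl !dotBr [dot z x]dotC.
by ring.
Qed.

(** Cauchy-Schwarz for a unit vector, from expanding
    [0 <= |z - |z| u|^2 = 2 |z| (|z| - u.z)]. *)
Lemma dot_unit_le u z : norm2 u = 1 -> dot u z <= norm2 z.
Proof.
move=> u1; have [->|z0] := eqVneq z 0.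
  by rewrite -[X in dot u X](scale0r 0) dotZr mul0r norm2_ge0.
rewrite -(ler_pM2l (_ : 0 < norm2 z)) ?norm2_gt0//.
have := sqr_ge0 (norm2 (z - norm2 z *: u)).
rewrite sqr_norm2B (norm2Z _ (norm2_ge0 _)) dotZl u1; nra.
Qed.

Lemma norm2_normalize x : x != 0 -> norm2 ((norm2 x)^-1 *: x) = 1.
Proof.
move=> x0; rewrite norm2Z ?invr_ge0 ?norm2_ge0// mulVf//.
by rewrite norm2_eq0.
Qed.

End UnitVector.

Section Plane.
Context {R : realType}.
Implicit Types (x y z u w : 'rV[R]_2) (a b : R).

Lemma pair2_0 a b : pair2 a b 0 0 = a.
Proof. by rewrite mxE. Qed.

Lemma pair2_1 a b : pair2 a b 0 1 = b.
Proof. by rewrite mxE. Qed.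

Lemma pair2K z : pair2 (z 0 0) (z 0 1) = z.
Proof.
apply/rowP => i; rewrite mxE.
by case: i => [[|[|//]] lt_i] /=; congr (z 0 _); apply/val_inj.
Qed.

Lemma dot2E x y : dot x y = x 0 0 * y 0 0 + x 0 1 * y 0 1.
Proof.
rewrite /dot !big_ord_recl big_ord0 addr0.
by congr (_ + x 0 _ * y 0 _); apply/val_inj.
Qed.

Lemma norm2_pair2 a b : norm2 (pair2 a b) = Num.sqrt (a ^+ 2 + b ^+ 2).
Proof. by rewrite /norm2 dot2E pair2_0 pair2_1 !expr2. Qed.

Lemma phi_FBE z : phi_FB z = dot (pair2 1 1) z - norm2 z.
Proof. by rewrite /norm2 !dot2E pair2_0 pair2_1 !mul1r -!expr2. Qed.

Lemma phi_FB_pair2 a b : phi_FB (pair2 a b) = a + b - Num.sqrt (a ^+ 2 + b ^+ 2).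
Proof. by rewrite /phi_FB pair2_0 pair2_1. Qed.

Lemma phi_FB_le0 a b : phi_FB (pair2 a b) <= 0 <-> a <= 0 \/ b <= 0.
Proof.
rewrite phi_FB_pair2 subr_le0.
have s0 := sqrtr_ge0 (a ^+ 2 + b ^+ 2).
have s2 : Num.sqrt (a ^+ 2 + b ^+ 2) ^+ 2 = a ^+ 2 + b ^+ 2.
  by rewrite sqr_sqrtr// addr_ge0 ?sqr_ge0.
split=> [h|]; last first.
  by move=> ab; have : a + b <= 0 \/ a * b <= 0; case: ab => ?; nra.
have [a0|a0] := leP a 0; first by left.
by right; rewrite leNgt; apply/negP => b0; nra.
Qed.

(** Squaring [a + b = sqrt (a^2 + b^2)] leaves [2 a b = 0]: the zeros are the
    boundary of the nonnegative quadrant, which the sign conditions of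
    I^{0+}, I^{+0} and I^{00} partition. *)
Lemma phi_FB_eq0 a b :
  phi_FB (pair2 a b) = 0 <-> [/\ 0 <= a, 0 <= b & a * b = 0].
Proof.
rewrite phi_FB_pair2.
have s0 := sqrtr_ge0 (a ^+ 2 + b ^+ 2).
have s2 : Num.sqrt (a ^+ 2 + b ^+ 2) ^+ 2 = a ^+ 2 + b ^+ 2.
  by rewrite sqr_sqrtr// addr_ge0 ?sqr_ge0.
split=> [/eqP|[a0 b0 ab0]]; last first.
  rewrite (_ : a ^+ 2 + b ^+ 2 = (a + b) ^+ 2); last by rewrite sqrrD ab0 mul0rn addr0.
  by rewrite sqrtr_sqr ger0_norm ?subrr// addr_ge0.
rewrite subr_eq0 => /eqP h; rewrite -h in s0 s2.
have ab0 : a * b = 0 by lra.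
by split=> //; have /eqP := ab0; rewrite mulf_eq0 => /orP[]/eqP ?; lra.
Qed.

(** The hypotheses say that [u] is a subgradient of the norm at [x]: the
    normalized [x], or any unit vector if [x = 0]. *)
Lemma phi_FB_supergradient u x : norm2 u = 1 -> dot u x = norm2 x ->
  forall z, phi_FB z - phi_FB x <= dot (pair2 1 1 - u) (z - x).
Proof.
move=> u1 ux z; have := dot_unit_le z u1.
by rewrite !phi_FBE dotBl !dotBr ux; lra.
Qed.

(** Both (1,1) - (1,0) and (1,1) - (-1,0) are supergradients at the origin, and
    a Frechet subgradient would equal each of them. *)
Lemma frechet_phi_FB0 y : ~ frechet_subdiff phi_FB 0 y.
Proof.
move=> Fy.
have unique_at a : a ^+ 2 = 1 -> y = pair2 1 1 - pair2 a 0.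
  move=> a1; apply: frechet_subdiff_supergradient Fy.
  apply: phi_FB_supergradient; first by rewrite norm2_pair2 a1 expr0n addr0 sqrtr1.
  by rewrite dot2E !mxE !mulr0 addr0; apply/esym/eqP; rewrite norm2_eq0.
have : y 0 0 = 1 - 1 by rewrite (unique_at 1) ?expr1n// !mxE.
have -> : y 0 0 = 1 - -1 by rewrite (unique_at (-1)) ?sqrrN ?expr1n// !mxE.
by lra.
Qed.

Definition grad_phi_FB z : 'rV[R]_2 := pair2 1 1 - (norm2 z)^-1 *: z.

(** The linearization error plus [|z - x|^2 / (2 |x|)] is the nonnegative
    number [(|z| - |x|)^2 / (2 |x|)], so the gradient is a proximal
    subgradient. *)
Lemma frechet_phi_FB_grad x : x != 0 ->
  frechet_subdiff phi_FB x (grad_phi_FB x).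
Proof.
move=> x0; apply: (@proximal_frechet_subdiff _ _ _ _ _ (2 * norm2 x)^-1) => z.
have nx : 0 < norm2 x by rewrite norm2_gt0.
rewrite -subr_ge0 sqr_norm2B !phi_FBE.
rewrite dotBl dotZl !dotBr -[dot x x]sqr_norm2.
rewrite [X in 0 <= X](_ : _ = (norm2 z - norm2 x) ^+ 2 / (2 * norm2 x)); last first.
  by field; rewrite gt_eqF.
by rewrite divr_ge0 ?sqr_ge0// mulr_ge0// ltW.
Qed.

Lemma frechet_phi_FB_inv x y : frechet_subdiff phi_FB x y ->
  x != 0 /\ y = grad_phi_FB x.
Proof.
move=> Fy; have [x0|x0] := eqVneq x 0.
  by rewrite x0 in Fy; case: (frechet_phi_FB0 Fy).
split=> //; apply: frechet_subdiff_supergradient Fy.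
apply: phi_FB_supergradient; first exact: norm2_normalize.
by rewrite dotZl -sqr_norm2 expr2 mulKf// norm2_eq0.
Qed.

(** Used with the two coordinate vectors: the Frechet subgradients satisfy
    [w.((1,1) - z/|z|) = 1 - w.z/|z| >= 0] by Cauchy-Schwarz, even when the
    points [z] tend to the origin. *)
Lemma mordukhovich_phi_FB_ge0 x y w :
    norm2 w = 1 -> dot w (pair2 1 1) = 1 ->
  mordukhovich_subdiff phi_FB x y -> 0 <= dot w y.
Proof.
move=> w1 w11 [x_ [y_ [Fy xx yy]]].
have wy : dot w (y_ j) @[j --> \oo] --> dot w y.
  by apply: cvg_dot => //; exact: cvg_cst.
apply: (closed_cvg _ (@closed_ge R 0) _ _ wy).
apply: nearW => j /=; have [xj0 ->] := frechet_phi_FB_inv (Fy j).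
rewrite dotBr w11 subr_ge0.
apply: le_trans (dot_unit_le _ w1) _.
by rewrite norm2_normalize.
Qed.

(** Away from the origin the gradient is continuous, so limits of gradients
    are the gradient at the limit point. *)
Lemma mordukhovich_phi_FB_neq0 x y : x != 0 ->
  mordukhovich_subdiff phi_FB x y -> y = grad_phi_FB x.
Proof.
move=> x0 [x_ [y_ [Fy xx yy]]].
have gx : grad_phi_FB (x_ j) @[j --> \oo] --> grad_phi_FB x.
  apply: (@cvgB R); first exact: cvg_cst.
  apply: (@cvgZ R) => //; apply: (@cvgV R); first by rewrite norm2_eq0.
  exact: cvg_norm2.
apply: (cvg_unique _ yy); first exact: norm_hausdorff.
have -> // : y_ = (fun j => grad_phi_FB (x_ j)).
by apply/funext => j; have [_ ->] := frechet_phi_FB_inv (Fy j).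
Qed.

Lemma mordukhovich_phi_FB_grad x : x != 0 ->
  mordukhovich_subdiff phi_FB x (grad_phi_FB x).
Proof.
move=> x0; apply: (@frechet_sub_mordukhovich _ _ _ _ _ (fun=> x)).
  exact: cvg_cst.
by move=> _; exact: frechet_phi_FB_grad.
Qed.

(** The gradient is constant, equal to (1,1) - u, along the ray spanned by
    [u]; the points [u / (j + 1)] of that ray tend to the origin. *)
Lemma mordukhovich_phi_FB0 u : norm2 u = 1 ->
  mordukhovich_subdiff phi_FB 0 (pair2 1 1 - u).
Proof.
move=> u1; apply: (@frechet_sub_mordukhovich _ _ _ _ _ (fun j => harmonic j *: u)).
  rewrite -[X in _ --> X](scale0r u); apply: (@cvgZ R); last exact: cvg_cst.
  exact: cvg_harmonic.
move=> j; have hj : 0 < harmonic j :> R by exact: harmonic_gt0.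
have hju : harmonic j *: u != 0.
  by rewrite -norm2_eq0 norm2Z ?ltW// u1 mulr1 gt_eqF.
have := frechet_phi_FB_grad hju.
by rewrite /grad_phi_FB norm2Z ?ltW// u1 mulr1 scalerA mulVf ?scale1r ?gt_eqF.
Qed.

Lemma grad_phi_FB_pair2l a : 0 < a -> grad_phi_FB (pair2 a 0) = pair2 0 1.
Proof.
move=> a0; rewrite -[LHS]pair2K /grad_phi_FB norm2_pair2.
rewrite expr0n addr0 sqrtr_sqr gtr0_norm// !mxE /=.
by rewrite mulVf ?gt_eqF// mulr0 subrr subr0.
Qed.

Lemma grad_phi_FB_pair2r b : 0 < b -> grad_phi_FB (pair2 0 b) = pair2 1 0.
Proof.
move=> b0; rewrite -[LHS]pair2K /grad_phi_FB norm2_pair2.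
rewrite expr0n add0r sqrtr_sqr gtr0_norm// !mxE /=.
by rewrite mulVf ?gt_eqF// mulr0 subrr subr0.
Qed.

End Plane.

(** * Cones of multipliers at the zeros of the Fischer-Burmeister function *)

Section ConesOfSubgradients.
Context {R : realType}.
Implicit Types (a b mu nu alpha beta : R).

(** At the origin, the ray through [(mu, nu)] has to meet the unit circle
    centred at (1,1).  With [(alpha, beta) = (mu, nu) / xi] this is the equation
    [xi^2 - 2 (mu + nu) xi + mu^2 + nu^2 = 0], whose discriminant is a positive
    multiple of [mu * nu >= 0]. *)
Lemma mordukhovich_phi_FB_cone a b mu nu :
    phi_FB (pair2 a b) = 0 -> 0 <= mu -> 0 <= nu ->
    (a != 0 -> mu = 0) -> (b != 0 -> nu = 0) ->
  exists xi alpha beta : R,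
    [/\ 0 <= xi,
        mordukhovich_subdiff phi_FB (pair2 a b) (pair2 alpha beta),
        xi * alpha = mu & xi * beta = nu].
Proof.
move=> /phi_FB_eq0[a0 b0 /eqP]; rewrite mulf_eq0 => ab0 mu0 nu0 amu bnu.
have pair2_neq0 c d : c != 0 \/ d != 0 -> pair2 c d != 0 :> 'rV[R]_2.
  move=> cd; apply/eqP => /rowP e.
  have := e 0; have := e 1; rewrite !mxE /= => d0 c0.
  by case: cd; rewrite ?c0 ?d0 eqxx.
have [a_eq0|a_neq0] := eqVneq a 0; last first.
  have b_eq0 : b = 0 by apply/eqP; rewrite (negbTE a_neq0) in ab0.
  have a_gt0 : 0 < a by rewrite lt_neqAle eq_sym a_neq0.
  exists nu, 0, 1; rewrite mulr0 mulr1 amu//; split=> //.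
  rewrite b_eq0 -(grad_phi_FB_pair2l a_gt0); apply: mordukhovich_phi_FB_grad.
  by apply: pair2_neq0; left.
have [b_eq0|b_neq0] := eqVneq b 0; last first.
  have b_gt0 : 0 < b by rewrite lt_neqAle eq_sym b_neq0.
  exists mu, 1, 0; rewrite mulr0 mulr1 bnu//; split=> //.
  rewrite a_eq0 -(grad_phi_FB_pair2r b_gt0); apply: mordukhovich_phi_FB_grad.
  by apply: pair2_neq0; right.
pose s := Num.sqrt (2 * mu * nu).
have s0 : 0 <= s := sqrtr_ge0 _.
have s2 : s ^+ 2 = 2 * mu * nu by rewrite sqr_sqrtr// !mulr_ge0.
have -> : pair2 a b = 0.
  by apply/rowP => i; rewrite !mxE a_eq0 b_eq0; case: i => [[|[|]]].
suff [xi [alpha [beta [xi0 ab1 xia xib]]]] : exists xi alpha beta : R,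
    [/\ 0 <= xi, (1 - alpha) ^+ 2 + (1 - beta) ^+ 2 = 1,
        xi * alpha = mu & xi * beta = nu].
  exists xi, alpha, beta; split=> //.
  have -> : pair2 alpha beta = pair2 1 1 - pair2 (1 - alpha) (1 - beta).
    by rewrite -[RHS]pair2K !mxE /= !subKr.
  by apply: mordukhovich_phi_FB0; rewrite norm2_pair2 ab1 sqrtr1.
(* If mu = nu = 0, any point of the circle will do, with xi = 0. *)
have [munu0|munu_neq0] := eqVneq (mu + nu) 0.
  exists 0, 1, 0; rewrite !mul0r; split=> //; [ring|lra|lra].
have xi_gt0 : 0 < mu + nu + s.
  by rewrite ltr_pwDl// lt_neqAle eq_sym munu_neq0 addr_ge0.
(* The larger root of the quadratic equation, which is positive. *)
exists (mu + nu + s), (mu / (mu + nu + s)), (nu / (mu + nu + s)); split.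
- exact: ltW.
- have -> : (1 - mu / (mu + nu + s)) ^+ 2 + (1 - nu / (mu + nu + s)) ^+ 2 =
      ((nu + s) ^+ 2 + (mu + s) ^+ 2) / (mu + nu + s) ^+ 2.
    by field; rewrite gt_eqF.
  rewrite (_ : (nu + s) ^+ 2 + (mu + s) ^+ 2 = (mu + nu + s) ^+ 2); last by nra.
  by rewrite divff// expf_neq0// gt_eqF.
- by rewrite mulrC divfK// gt_eqF.
- by rewrite mulrC divfK// gt_eqF.
Qed.

(** Each conclusion is a linear inequality, or two opposite ones, satisfied by
    the Mordukhovich subgradients, hence by their closed convex hull. *)
Lemma clarke_phi_FB_cone a b alpha beta :
    phi_FB (pair2 a b) = 0 ->
    clarke_subdiff phi_FB (pair2 a b) (pair2 alpha beta) ->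
  [/\ 0 <= alpha, 0 <= beta, a != 0 -> alpha = 0 & b != 0 -> beta = 0].
Proof.
move=> /phi_FB_eq0[a0 b0 /eqP]; rewrite mulf_eq0 => ab0 Cab.
have dotp c d (y : 'rV[R]_2) : dot (pair2 c d) y = c * y 0 0 + d * y 0 1.
  by rewrite dot2E pair2_0 pair2_1.
have half c d : (forall y, mordukhovich_subdiff phi_FB (pair2 a b) y ->
    0 <= dot (pair2 c d) y) -> 0 <= c * alpha + d * beta.
  move=> hM; have := clarke_subdiff_halfspace hM Cab.
  by rewrite dotp pair2_0 pair2_1.
have alpha0 : 0 <= alpha.
  have : 0 <= 1 * alpha + 0 * beta.
    apply: half => y; apply: mordukhovich_phi_FB_ge0.
      by rewrite norm2_pair2 expr1n expr0n addr0 sqrtr1.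
    by rewrite dotp pair2_0 pair2_1; lra.
  lra.
have beta0 : 0 <= beta.
  have : 0 <= 0 * alpha + 1 * beta.
    apply: half => y; apply: mordukhovich_phi_FB_ge0.
      by rewrite norm2_pair2 expr1n expr0n add0r sqrtr1.
    by rewrite dotp pair2_0 pair2_1; lra.
  lra.
split=> // [a_neq0|b_neq0].
- have b_eq0 : b = 0 by apply/eqP; rewrite (negbTE a_neq0) in ab0.
  have a_gt0 : 0 < a by rewrite lt_neqAle eq_sym a_neq0.
  have : 0 <= -1 * alpha + 0 * beta.
    apply: half => y /mordukhovich_phi_FB_neq0 ->.
      by rewrite b_eq0 grad_phi_FB_pair2l// dotp pair2_0 pair2_1; lra.
    by apply/eqP => /rowP/(_ 0); rewrite !mxE /= => /eqP; rewrite (negbTE a_neq0).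
  by lra.
- have a_eq0 : a = 0 by apply/eqP; rewrite (negbTE b_neq0) orbF in ab0.
  have b_gt0 : 0 < b by rewrite lt_neqAle eq_sym b_neq0.
  have : 0 <= 0 * alpha + -1 * beta.
    apply: half => y /mordukhovich_phi_FB_neq0 ->.
      by rewrite a_eq0 grad_phi_FB_pair2r// dotp pair2_0 pair2_1; lra.
    by apply/eqP => /rowP/(_ 1); rewrite !mxE /= => /eqP; rewrite (negbTE b_neq0).
  by lra.
Qed.

End ConesOfSubgradients.

(** * Active or-constraints *)

Section OrConstraints.
Context {R : realType} {n q : nat}.
Variables (G H : 'I_q -> 'rV[R]_n -> R) (x : 'rV[R]_n).

Lemma I_0p_00E :
  (I_0p G H x :|: I_00 G H x)%SET = [set l in I_phi G H phi_FB x | G l x == 0]%SET.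
Proof.
apply/setP => l; rewrite !inE.
apply/idP/andP => [h|[/eqP/phi_FB_eq0[_ H0 _] G0]].
  have [G0 H0] : G l x = 0 /\ 0 <= H l x.
    by case/orP: h => /andP[/eqP ->]; [move=> /ltW|move=> /eqP ->].
  rewrite G0 eqxx; split=> //; apply/eqP/phi_FB_eq0.
  by split=> //; rewrite mul0r.
by rewrite G0 /= orbC eq_sym -le_eqVlt.
Qed.

Lemma I_p0_00E :
  (I_p0 G H x :|: I_00 G H x)%SET = [set l in I_phi G H phi_FB x | H l x == 0]%SET.
Proof.
apply/setP => l; rewrite !inE.
apply/idP/andP => [h|[/eqP/phi_FB_eq0[G0 _ _] H0]].
  have [H0 G0] : H l x = 0 /\ 0 <= G l x.
    by case/orP: h => /andP[+ /eqP ->]; [move=> /ltW|move=> /eqP ->].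
  rewrite H0 eqxx; split=> //; apply/eqP/phi_FB_eq0.
  by split=> //; rewrite mulr0.
by rewrite H0 !andbT orbC eq_sym -le_eqVlt.
Qed.

(** The sums in the W-stationarity and KKT systems run over different index
    sets; extending the multipliers by zero brings both to the active set of
    the reformulation. *)
Lemma sum_active_pairs (mu nu : 'I_q -> R) :
  \sum_(l in (I_0p G H x :|: I_00 G H x)%SET) mu l *: gradient (G l) x +
  \sum_(l in (I_p0 G H x :|: I_00 G H x)%SET) nu l *: gradient (H l) x =
  \sum_(l in I_phi G H phi_FB x)
    ((if G l x == 0 then mu l else 0) *: gradient (G l) x +
     (if H l x == 0 then nu l else 0) *: gradient (H l) x).
Proof.
rewrite I_0p_00E I_p0_00E.
under eq_bigl => l do rewrite inE.
under [X in _ + X]eq_bigl => l do rewrite inE.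
rewrite !big_mkcondr -big_split /=; apply: eq_bigr => l _.
by congr (_ + _); case: ifP => //; rewrite scale0r.
Qed.

End OrConstraints.

(** * Equivalence of the stationarity concepts *)

Theorem proposition3p5 (R : realType) (n m p q : nat)
  (n_gt0 : (0 < n)%N) (m_gt0 : (0 < m)%N) (p_gt0 : (0 < p)%N) (q_gt0 : (0 < q)%N)
  (f : 'rV[R]_n -> R)
  (g : 'I_m -> 'rV[R]_n -> R) (h : 'I_p -> 'rV[R]_n -> R)
  (G H : 'I_q -> 'rV[R]_n -> R)
  (f_C1 : continuously_differentiable f)
  (g_C1 : forall i, continuously_differentiable (g i))
  (h_C1 : forall j, continuously_differentiable (h j))
  (G_C1 : forall l, continuously_differentiable (G l))
  (H_C1 : forall l, continuously_differentiable (H l))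
  (x : 'rV[R]_n) (x_feasible : mpoc_feasible g h G H x) :
  (W_stationary f g h G H x <->
     KKT_point f g h G H clarke_subdiff phi_FB x) /\
  (KKT_point f g h G H clarke_subdiff phi_FB x <->
     KKT_point f g h G H mordukhovich_subdiff phi_FB x).
Proof.
have phi_feasible : mpoc_phi_feasible g h G H phi_FB x.
  case: x_feasible => gx hx GHx; split=> // l.
  exact/phi_FB_le0.
have WM : W_stationary f g h G H x ->
    KKT_point f g h G H mordukhovich_subdiff phi_FB x.
  move=> [_ [lambda [rho [mu [nu [lambda0 mu0 nu0 stat]]]]]]; split=> //.
  (* The triple t collects (xi, alpha, beta) for the index l. *)
  have multipliers l : exists t : R * R * R, l \in I_phi G H phi_FB x ->
      [/\ 0 <= t.1.1,
          mordukhovich_subdiff phi_FB (pair2 (G l x) (H l x)) (pair2 t.1.2 t.2),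
          t.1.1 * t.1.2 = (if G l x == 0 then mu l else 0) &
          t.1.1 * t.2 = (if H l x == 0 then nu l else 0)].
    have [lI|lI] := boolP (l \in I_phi G H phi_FB x); last by exists (0, 0, 0).
    have phi0 : phi_FB (pair2 (G l x) (H l x)) = 0.
      by move: (lI); rewrite inE => /eqP.
    have [||||xi [alpha [beta [? ? ? ?]]]] := @mordukhovich_phi_FB_cone R
        (G l x) (H l x) (if G l x == 0 then mu l else 0)
        (if H l x == 0 then nu l else 0) phi0.
    - by case: ifP => // G0; apply: mu0; rewrite I_0p_00E inE lI.
    - by case: ifP => // H0; apply: nu0; rewrite I_p0_00E inE lI.
    - by move=> /negbTE ->.
    - by move=> /negbTE ->.
    by exists (xi, alpha, beta).
  have [t tP] := choice multipliers.
  exists lambda, rho, (fun l => (t l).1.1), (fun l => (t l).1.2), (fun l => (t l).2).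
  split=> // [l /tP[]//|l /tP[]//|].
  rewrite {1}stat -addrA sum_active_pairs; congr (_ + _).
  apply: eq_bigr => l /tP[_ _ <- <-].
  by rewrite scalerDr !scalerA.
have MC : KKT_point f g h G H mordukhovich_subdiff phi_FB x ->
    KKT_point f g h G H clarke_subdiff phi_FB x.
  move=> [? [lambda [rho [xi [alpha [beta [? ? sub ?]]]]]]]; split=> //.
  exists lambda, rho, xi, alpha, beta; split=> // l /sub.
  exact: mordukhovich_sub_clarke.
have CW : KKT_point f g h G H clarke_subdiff phi_FB x ->
    W_stationary f g h G H x.
  move=> [_ [lambda [rho [xi [alpha [beta [lambda0 xi0 sub stat]]]]]]]; split=> //.
  have cone l : l \in I_phi G H phi_FB x ->
      [/\ 0 <= alpha l, 0 <= beta l, G l x != 0 -> alpha l = 0 &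
          H l x != 0 -> beta l = 0].
    move=> lI; apply: clarke_phi_FB_cone (sub l lI).
    by move: lI; rewrite inE => /eqP.
  exists lambda, rho, (fun l => xi l * alpha l), (fun l => xi l * beta l).
  split=> // [l|l|].
  - rewrite I_0p_00E inE => /andP[lI _].
    by have [? _ _ _] := cone l lI; rewrite mulr_ge0// xi0.
  - rewrite I_p0_00E inE => /andP[lI _].
    by have [_ ? _ _] := cone l lI; rewrite mulr_ge0// xi0.
  - rewrite {1}stat -[RHS]addrA sum_active_pairs; congr (_ + _).
    apply: eq_bigr => l /cone[_ _ alpha0 beta0].
    rewrite scalerDr !scalerA; congr (_ *: _ + _ *: _).
      by case: eqP => // /eqP/alpha0 ->; rewrite mulr0.
    by case: eqP => // /eqP/beta0 ->; rewrite mulr0.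
by split; split; [move=> /WM/MC|move=> /CW|move=> /CW/WM|move=> /MC].
Qed.
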